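(* (i) For every fixed $n\in\mathbb{N}$ and every fixed subgroup $B\le\mathcal{S}_n$, the set $\{\delta(A\wr_I B)\mid A\le\mathcal{S}_m\text{ primitive},\ m\in\mathbb{N}\}$ is dense in the interval $[\delta(B),1]$. (ii) For every fixed $m\in\mathbb{N}$ and every fixed subgroup $A\le\mathcal{S}_m$, the set $\{\delta(A\wr_I B)\mid B\le\mathcal{S}_n\text{ imprimitive},\ n\in\mathbb{N}\}$ is dense in the interval $[\delta(A),1]$.
   Context: $\mathbb{N}$ is the set of positive integers; $\mathcal{S}_n$ is the symmetric group on $[n]=\{1,\dots,n\}$; permutations act on the right, $x\mapsto xg$. For a finite group $G$ acting on a finite set $X$, $\delta(G)=\delta(G,X)$ is the proportion of elements of $G$ with no fixed point in $X$; subgroups of $\mathcal{S}_n$ act naturally on $[n]$. Primitive means transitive and preserving no nontrivial partition; imprimitive means transitive but not primitive. For $A\le\mathcal{S}_m$, $B\le\mathcal{S}_n$, the wreath product $A\wr B=A^{[n]}\rtimes B$ has underlying set $A^{[n]}\times B$ ($A^{[n]}$ being the group of functions $[n]\to A$ under pointwise multiplication) and multiplication $(\alpha,b)(\beta,c)=(\alpha\beta^{b^{-1}},bc)$, where $\beta^{b}(y)=\beta(yb^{-1})$. $A\wr_I B$ denotes $A\wr B$ acting on $[m]\times[n]$ by $(x,y)(\alpha,b)=(x\alpha(y),yb)$. *)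

(* Defs.v *)
From HB Require Import structures.
From mathcomp Require Import all_boot all_order all_algebra all_fingroup.
From mathcomp Require Import all_solvable.
From mathcomp Require Import all_classical all_reals all_analysis.
Import numFieldNormedType.Exports.

Set Implicit Arguments.
Unset Strict Implicit.
Unset Printing Implicit Defensive.

Local Open Scope group_scope.

(* Points are numbered from 0: ['I_n] stands for [n] = {1, ..., n}.  Products
   in ['S_n] compose from left to right, [(s * t) x = t (s x)], so that the
   image of [x] under [g] acting on the right is [g x]. *)

(* ['S_m wr 'S_n]; a separate type is used because pairs already carry the
   direct product structure. *)
Record wreath (m n : nat) : Type := Wreath {
  wbase : {ffun 'I_n -> 'S_m};
  wtop : 'S_n }.

Section WreathProduct.
Context {m n : nat}.
Implicit Types (u v w : wreath m n) (f : {ffun 'I_n -> 'S_m}) (b : 'S_n).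

Definition wpair u := (wbase u, wtop u).
Definition wunpair (p : {ffun 'I_n -> 'S_m} * 'S_n) := Wreath p.1 p.2.
Lemma wpairK : cancel wpair wunpair. Proof. by case. Qed.

HB.instance Definition _ := Finite.copy (wreath m n) (can_type wpairK).

Lemma wreath_eq u v :
  (forall y, wbase u y = wbase v y) -> wtop u = wtop v -> u = v.
Proof.
by case: u v => f b [g c] /= fg bc; congr Wreath => //; apply/ffunP.
Qed.

(* [f ^ b : y |-> f (y b^-1)] *)
Definition wshift f b : {ffun 'I_n -> 'S_m} := [ffun y => f (b^-1 y)].

Definition wmul u v : wreath m n :=
  Wreath [ffun y => wbase u y * wshift (wbase v) (wtop u)^-1 y]
         (wtop u * wtop v).
Definition wone : wreath m n := Wreath [ffun=> 1] 1.
Definition winv u : wreath m n :=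
  Wreath [ffun y => (wshift (wbase u) (wtop u) y)^-1] (wtop u)^-1.

Lemma wmulA : associative wmul.
Proof.
move=> u v w; apply: wreath_eq => [y|] /=; last by rewrite mulgA.
by rewrite !ffunE /= ?invgK ?ffunE ?invgK ?permM ?mulgA.
Qed.

Lemma wmul1 : left_id wone wmul.
Proof.
move=> u; apply: wreath_eq => [y|] /=; last by rewrite mul1g.
by rewrite !ffunE invgK perm1 mul1g.
Qed.

Lemma wmulV : left_inverse wone winv wmul.
Proof.
move=> u; apply: wreath_eq => [y|] /=; last by rewrite mulVg.
by rewrite !ffunE invgK mulVg.
Qed.

HB.instance Definition _ :=
  Finite_isGroup.Build (wreath m n) wmulA wmul1 wmulV.

Definition wr_set (A : {set 'S_m}) (B : {set 'S_n}) : {set wreath m n} :=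
  [set u : wreath m n | [forall y, wbase u y \in A] && (wtop u \in B)].

Lemma wr_group_set (A : {group 'S_m}) (B : {group 'S_n}) :
  group_set (wr_set A B).
Proof.
apply/group_setP; split=> [|u v].
  by rewrite inE /= group1 andbT; apply/forallP => y; rewrite ffunE group1.
rewrite !inE => /andP[/forallP Au Bu] /andP[/forallP Av Bv] /=.
by rewrite groupM // andbT; apply/forallP => y; rewrite !ffunE groupM.
Qed.

Canonical wr_group (A : {group 'S_m}) (B : {group 'S_n}) :=
  Group (wr_group_set A B).

Definition wr_imprim (p : 'I_m * 'I_n) u : 'I_m * 'I_n :=
  (wbase u p.2 p.1, wtop u p.2).

Lemma wr_imprim_is_action : is_action [set: wreath m n] wr_imprim.
Proof.
apply: is_total_action => [[x y]|[x y] u v].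
  by rewrite /wr_imprim /= ffunE !perm1.
by rewrite /wr_imprim /= !ffunE invgK !permM.
Qed.

Definition wr_action : {action wreath m n &-> 'I_m * 'I_n} :=
  Action wr_imprim_is_action.

End WreathProduct.

Definition delta (R : realType) (gT : finGroupType) (T : finType)
    (to : {action gT &-> T}) (G : {group gT}) : R :=
  (#|[set g in G | [forall x : T, to x g != x]]%SET|%:R / #|G|%:R)%R.

Definition delta_perm (R : realType) (n : nat) (G : {group 'S_n}) : R :=
  delta R 'P%act G.

(* [delta (A wr_I B)] *)
Definition delta_wrI (R : realType) (m n : nat)
    (A : {group 'S_m}) (B : {group 'S_n}) : R :=
  delta R wr_action (wr_group A B).

Definition perm_primitive (n : nat) (G : {group 'S_n}) : bool :=
  [primitive G, on [set: 'I_n]%SET | 'P].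

Definition perm_imprimitive (n : nat) (G : {group 'S_n}) : bool :=
  [transitive G, on [set: 'I_n]%SET | 'P] && ~~ perm_primitive G.

(* [S] is a subset of [X], dense for the topology that [X] inherits from [T];
   [topology_structure.dense] is density in the whole space. *)
Definition dense_in (T : topologicalType) (S X : set T) : Prop :=
  (S `<=` X)%classic /\ (X `<=` closure S)%classic.

(* Main.v *)
(* For a group [G] acting on a finite set let [P_G(t)] be the average over [G]
   of [t ^ (number of fixed points)], so that [delta G = P_G(0)].  In the
   imprimitive action [P_(A wr B) = P_B o P_A], hence
   [delta (A wr_I B) = P_B (delta A)].

   (i) As [P_B] maps [[0, 1]] continuously onto [[delta B, 1]], it is enough
   that the numbers [delta A], [A] primitive, are dense in [[0, 1]].  Start from
   [AGL_1(q)], for which [delta = 1/q], and iterate the wreath product with a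
   cyclic group of large prime order [p] in the product action: this preserves
   primitivity and turns [s = delta A] into [s + ((1 - s) - (1 - s)^p) / p], so
   that [delta] climbs to 1 by steps of at most [1/p].

   (ii) By Burnside's lemma and Bernoulli's inequality [P_B(t) >= t] for [B]
   transitive.  For [C = AGL_1(q)] the difference [P_C(t) - t] is at most
   [1/(q - 1)] and positive for [t < 1], so the values [P_C(... P_C(a))] with at
   least two factors, which belong to the imprimitive groups
   [C wr_I ... wr_I C], are nearly dense in [[a, 1]] when [q] is large. *)

Require Import Defs.
From mathcomp Require Import all_boot all_order all_algebra all_fingroup.
From mathcomp Require Import all_solvable.
From mathcomp Require Import ring lra.
Import Order.TTheory GRing.Theory Num.Theory.

Set Implicit Arguments.
Unset Strict Implicit.
Unset Printing Implicit Defensive.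

Local Open Scope group_scope.

(** * Primitivity by means of invariant equivalence relations *)

Section Congruences.
Variables (gT : finGroupType) (T : finType).
Implicit Types (to : {action gT &-> T}) (G : {group gT}) (e : rel T).

Definition congruence to G e :=
  equivalence_rel e /\
  forall g x y, g \in G -> e x y -> e (to x g) (to y g).

(** Relations replace the block systems of the library predicate because they pull back along maps
    directly, with no sets of sets to transport. *)
Definition congruence_simple to G :=
  forall e, congruence to G e ->
    (forall x y, e x y -> x = y) \/ (forall x y, e x y).

Let block e x := [set y in [set: T] | e x y].

Let eq_block e x y : equivalence_rel e -> (block e x == block e y) = e x y.
Proof.
move=> eqe; apply/eqP/idP => [/setP/(_ y)|exy].
  by rewrite !inE (eqe y y y).1.
by apply/setP => z; rewrite !inE /= (eqe x y z).2.
Qed.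

Let acts_blocks to G e : congruence to G e ->
  [acts G, on equivalence_partition e [set: T] | to^*].
Proof.
case=> eqe Ge; apply/subsetP => g Gg; rewrite !inE /=.
apply/subsetP => _ /imsetP[x _ ->]; rewrite inE.
suff -> : to^* (block e x) g = block e (to x g) by rewrite imset_f ?inE.
apply/setP => y.
rewrite -{1}(actKV to g y) (mem_imset _ _ (act_inj to g)) !inE /=.
apply/idP/idP => exy; last by have := Ge _ _ _ (groupVr Gg) exy; rewrite actK.
by have := Ge _ _ _ Gg exy; rewrite actKV.
Qed.

Let card_blocks_lt e : equivalence_rel e ->
  #|equivalence_partition e [set: T]| < #|[set: T]| <->
  ~ (forall x y, e x y -> x = y).
Proof.
move=> eqe; rewrite ltn_neqAle leq_imset_card andbT; split=> [/imset_injP|] h.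
  by move=> h'; apply: h => x y _ _ /eqP; rewrite eq_block // => /h'.
apply/imset_injP => h'; apply: h => x y exy.
by apply: h'; rewrite ?inE //; apply/eqP; rewrite eq_block.
Qed.

Let card_blocks_gt1 e : equivalence_rel e ->
  1 < #|equivalence_partition e [set: T]| <-> ~ (forall x y, e x y).
Proof.
move=> eqe; split.
  case/card_gt1P => [_ [_ [/imsetP[x _ ->] /imsetP[y _ ->]]]].
  by rewrite eq_block // => /negP nxy h; apply: nxy; apply: h.
move=> h; have /existsP[x /existsP[y nxy]] : [exists x, [exists y, ~~ e x y]].
  apply: contra_notT h => /existsPn nexy x y.
  by have /existsPn/(_ y)/negPn := nexy x.
apply/card_gt1P; exists (block e x), (block e y).
by rewrite eq_block // !imset_f ?inE.
Qed.

(** A congruence corresponds to the partition into its classes. The partition has fewer classes than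
    points unless the congruence is equality, and more than one class unless it is total. *)
Lemma primitive_congruenceP to G :
  [primitive G, on [set: T] | to] <->
  [transitive G, on [set: T] | to] /\ congruence_simple to G.
Proof.
split=> [/andP[trG nimp]|[trG simG]].
  split=> // e ce; have [eqe _] := ce.
  case: (ltnP #|equivalence_partition e [set: T]| #|[set: T]|) => [lt|ge];
    last first.
    left=> x y exy; apply/eqP; move: ge; apply: contraLR => nxy.
    rewrite -ltnNge; apply/card_blocks_lt => // /(_ x y exy) xy.
    by rewrite xy eqxx in nxy.
  right=> x y; apply: contraNT nimp => nexy; apply/existsP.
  exists (equivalence_partition e setT).
  rewrite /imprimitivity_system acts_blocks // lt equivalence_partitionP /=.
    by rewrite andbT; apply/card_blocks_gt1 => // /(_ x y); apply/negP.
  by move=> ? ? ? _ _ _; apply: eqe.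
apply/andP; split=> //; apply/existsP => -[Q /and3P[pQ aQ /andP[gt1 ltT]]].
pose e x y := y \in pblock Q x.
have eqe : equivalence_rel e.
  by move=> x y z; apply: (pblock_equivalence pQ); rewrite inE.
have defQ : equivalence_partition e setT = Q := equivalence_partition_pblock pQ.
rewrite -defQ in gt1 ltT.
move/(card_blocks_gt1 eqe): gt1 => gt1; move/(card_blocks_lt eqe): ltT => ltT.
have [|//|//] := simG e; split=> // g x y Gg; rewrite /e => xy.
have [/eqP cQ tiQ _] := and3P pQ.
have Qx : pblock Q x \in Q by rewrite pblock_mem // cQ inE.
have Qxg : to^* (pblock Q x) g \in Q by rewrite (actsP aQ).
have xx : x \in pblock Q x by rewrite mem_pblock cQ inE.
by rewrite (def_pblock tiQ Qxg) ?mem_setact ?imset_f.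
Qed.

End Congruences.

(** * The fixed-point polynomial $P_G$ *)

Section FixedPointPolynomial.
Variable R : realFieldType.

Definition fixgf (gT : finGroupType) (T : finType) (to : {action gT &-> T})
    (G : {group gT}) (t : R) : R :=
  (#|G|%:R^-1 * \sum_(g in G) t ^+ #|'Fix_to[g]|)%R.

Section Action.
Variables (gT : finGroupType) (T : finType).
Variables (to : {action gT &-> T}) (G : {group gT}).
Local Notation P := (fixgf to G).

Let cardG_gt0 : (0 < #|G|%:R :> R)%R. Proof. by rewrite ltr0n cardG_gt0. Qed.
Let cardG_neq0 : (#|G|%:R != 0 :> R)%R. Proof. by rewrite gt_eqF. Qed.

Lemma fixgf1 : P 1 = 1%R.
Proof.
rewrite /fixgf (eq_bigr (fun=> 1%R)) => [|g _]; last by rewrite expr1n.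
by rewrite sumr_const mulVf.
Qed.

Lemma fixgf_horner t :
  P t = (#|G|%:R^-1 *: \sum_(g in G) 'X ^+ #|'Fix_to[g]| : {poly R})%R.[t]%R.
Proof.
rewrite hornerZ horner_sum; congr (_ * _)%R.
by apply: eq_bigr => g _; rewrite hornerXn.
Qed.

Lemma le_fixgf s t : (0 <= s -> s <= t -> P s <= P t)%R.
Proof.
move=> s0 st; rewrite ler_wpM2l ?invr_ge0 ?ler0n //.
by apply: ler_sum => g _; rewrite lerXn2r ?nnegrE // (le_trans s0).
Qed.

(** At 0 only the terms with exponent 0 survive, since [0 ^+ 0 = 1]. *)
Lemma fixgf_derangements :
  P 0 = (#|[set g in G | [forall x : T, to x g != x]]|%:R / #|G|%:R)%R.
Proof.
rewrite /fixgf mulrC; congr (_ / _)%R.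
rewrite -sum1_card natr_sum big_mkcond [RHS]big_mkcond; apply: eq_bigr => g _.
rewrite inE; case: (g \in G) => //=; rewrite expr0n.
suff -> : (#|'Fix_to[g]| == 0%N) = [forall x, to x g != x] by case: ifP.
rewrite cards_eq0; apply/eqP/forallP => [fix0 x|nfix].
  by apply/negP => /eqP/afix1P; rewrite fix0 inE.
by apply/setP => x; rewrite in_set0; apply/negbTE/afix1P/eqP.
Qed.

Lemma ler_Bernoulli n (s : R) : (0 <= s <= 1 -> 1 - s *+ n <= (1 - s) ^+ n)%R.
Proof.
case/andP=> s0 s1; elim: n => [|n IHn]; first by rewrite mulr0n subr0.
rewrite exprS; have s1' : (0 <= 1 - s)%R by rewrite subr_ge0.
apply: le_trans (ler_wpM2l s1' IHn); rewrite mulrS -[(s *+ n)%R]mulr_natl.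
by have := ler0n R n; nra.
Qed.

(* By Burnside's lemma the average number of fixed points is 1, so this is
   Jensen's inequality for [k |-> t ^+ k]. *)
Lemma fixgf_ge t : [transitive G, on [set: T] | to] ->
  (0 <= t <= 1 -> t <= P t)%R.
Proof.
move=> trG /andP[t0 t1].
have fixE : \sum_(g in G) #|'Fix_to[g]| = #|G|.
  have := Frobenius_Cauchy (atrans_acts trG).
  have -> : orbit to G @: [set: T] = [set setT].
    have /imsetP[x _ _] := trG.
    apply/setP => X; rewrite inE; apply/imsetP/eqP => [[y _ ->]|->].
      by rewrite (atransP trG) ?inE.
    by exists x; rewrite ?inE // (atransP trG) ?inE.
  by rewrite cards1 mul1n => <-; apply: eq_bigr => g _; rewrite setTI.
have {1}-> : t = (#|G|%:R^-1 * \sum_(g in G) (1 - (1 - t) *+ #|'Fix_to[g]|))%R.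
  rewrite sumrB sumr_const sumrMnr fixE -mulrnBl subKr.
  by rewrite -[(t *+ _)%R]mulr_natl mulrA mulVf ?mul1r.
rewrite ler_wpM2l ?invr_ge0 ?ler0n //; apply: ler_sum => g _.
by rewrite (le_trans (ler_Bernoulli _ _)) ?subr_ge0 ?t1 ?gerBl ?subKr.
Qed.

End Action.

(** The fibres of [f] are the cosets of its kernel. *)
Lemma sum_morphim (gT hT : finGroupType) (G : {group gT})
    (f : {morphism G >-> hT}) (F : hT -> R) :
  (\sum_(g in G) F (f g) = #|'ker f|%:R * \sum_(a in f @* G) F a)%R.
Proof.
rewrite morphimEdom (partition_big_imset f) /= mulr_sumr.
apply: eq_bigr => _ /imsetP[g Gg ->].
rewrite (eq_bigr (fun=> F (f g))) => [|h /andP[_ /eqP->]] //.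
rewrite sumr_const -[LHS]mulr_natl; congr (_%:R * _)%R.
rewrite -(card_rcoset _ g) -morphpre_set1 //; apply: eq_card => h.
by rewrite [in LHS]unfold_in /= !inE.
Qed.

End FixedPointPolynomial.

(** * From an action on a finite type to a subgroup of a symmetric group *)

Section Relabel.
Variables (gT : finGroupType) (T : finType) (to : {action gT &-> T}).

Let relabel_fun g (i : 'I_#|T|) := enum_rank (to (enum_val i) g).

Let relabel_fun_inj g : injective (relabel_fun g).
Proof. by move=> i j /enum_rank_inj /act_inj /enum_val_inj. Qed.

(** The groups built below act on fields, pairs and functions, whereas the theorem speaks of
    subgroups of ['S_n]; [enum_rank] numbers the points. *)
Definition relabel g : 'S_#|T| := perm (@relabel_fun_inj g).

Lemma relabelE g x : relabel g (enum_rank x) = enum_rank (to x g).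
Proof. by rewrite permE /relabel_fun enum_rankK. Qed.

Variable G : {group gT}.

Let relabelM : {in G &, {morph relabel : g h / g * h}}.
Proof.
move=> g h _ _; apply/permP => i; rewrite -(enum_valK i) permM !relabelE.
by rewrite actM.
Qed.

Canonical relabel_morphism := Morphism relabelM.
Definition relabel_group := [group of relabel_morphism @* G].

Lemma relabel_fix g : #|afix 'P [set relabel g]| = #|'Fix_to[g]|.
Proof.
rewrite -[RHS](card_imset _ enum_rank_inj); apply: eq_card => i.
rewrite -(enum_valK i) mem_imset; last exact: enum_rank_inj.
apply/afix1P/afix1P; rewrite /= /aperm relabelE; last by move->.
exact: enum_rank_inj.
Qed.

(** Passing to the image divides both the sum and the group order by the order of the kernel, so the
    average is the same. *)
Lemma fixgf_relabel (R : realFieldType) (t : R) :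
  fixgf 'P relabel_group t = fixgf to G t.
Proof.
rewrite /fixgf; under [in RHS]eq_bigr do rewrite -relabel_fix.
rewrite (sum_morphim relabel_morphism (fun a => t ^+ #|afix 'P [set a]|)%R).
have /eqP := sum_morphim relabel_morphism (fun=> 1%R : R).
rewrite !sumr_const => /eqP ->; rewrite invfM mulrACA.
by rewrite mulVf ?mul1r // pnatr_eq0 -lt0n cardG_gt0.
Qed.

Lemma relabel_transitive :
  [transitive G, on [set: T] | to] ->
  [transitive relabel_group, on [set: 'I_#|T|] | 'P].
Proof.
move=> trG; have /imsetP[x _ _] := trG.
apply/imsetP; exists (enum_rank x); rewrite ?inE //; apply/setP => i.
rewrite inE; symmetry; apply/orbitP.
have [g Gg gx] := atransP2 trG (in_setT x) (in_setT (enum_val i)).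
exists (relabel g); first exact: mem_morphim.
by rewrite /= /aperm relabelE -gx enum_valK.
Qed.

Lemma relabel_congruence_simple :
  congruence_simple 'P relabel_group <-> congruence_simple to G.
Proof.
split=> simG e [eqe Ge].
  have [|h|h] := simG (fun i j => e (enum_val i) (enum_val j)).
  - split=> [i j k|a i j]; first exact: eqe.
    case/morphimP=> g _ Gg ->; rewrite -{2}(enum_valK i) -{2}(enum_valK j) /=.
    by rewrite /aperm !relabelE !enum_rankK; apply: Ge.
  - left=> x y; rewrite -{1}(enum_rankK x) -{1}(enum_rankK y) => /h.
    exact: enum_rank_inj.
  - by right=> x y; rewrite -(enum_rankK x) -(enum_rankK y).
have [|h|h] := simG (fun x y => e (enum_rank x) (enum_rank y)).
- split=> [x y z|g x y Gg]; first exact: eqe.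
  move/(Ge (relabel g)); rewrite /= /aperm !relabelE; apply.
  exact: mem_morphim.
- left=> i j; rewrite -{1}(enum_valK i) -{1}(enum_valK j) => /h.
  exact: enum_val_inj.
- by right=> i j; rewrite -(enum_valK i) -(enum_valK j).
Qed.

End Relabel.

(** * Composition of fixed-point polynomials in the imprimitive action *)

Section ImprimitiveWreath.
Variables (m n : nat) (A : {group 'S_m}) (B : {group 'S_n}).

Lemma sum_wr (V : nmodType) (F : {ffun 'I_n -> 'S_m} -> 'S_n -> V) :
  (\sum_(u in wr_group A B) F (wbase u) (wtop u) =
   \sum_(b in B) \sum_(f in ffun_on A) F f b)%R.
Proof.
rewrite (reindex (fun p => Wreath p.2 p.1)) /=; last first.
  by exists (fun u => (wtop u, wbase u)) => [[]|[]].
rewrite pair_big; apply: eq_bigl => -[b f]; rewrite !inE /= andbC.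
by congr (_ && _); apply/forallP/ffun_onP.
Qed.

Lemma card_wr : #|wr_group A B| = (#|A| ^ n * #|B|)%N.
Proof.
rewrite -sum1_card (sum_wr (fun _ _ => 1%N)).
transitivity (\sum_(b in B) #|A| ^ n)%N; last by rewrite sum_nat_const mulnC.
by apply: eq_bigr => b _; rewrite sum1_card card_ffun_on card_ord.
Qed.

Lemma wr_action_fix (u : wreath m n) :
  (#|'Fix_wr_action[u]| =
   \sum_(y | wtop u y == y) #|afix 'P [set wbase u y]|)%N.
Proof.
pose fixed x y : nat := (x, y) \in 'Fix_wr_action[u].
transitivity (\sum_p fixed p.1 p.2)%N.
  by rewrite -sum1_card big_mkcond; apply: eq_bigr => -[x y] _.
rewrite -(pair_bigA _ fixed) exchange_big /=.
rewrite [RHS]big_mkcond; apply: eq_bigr => y _.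
rewrite -sum1_card; case: eqP => [fy|nfy]; last first.
  rewrite big1 // => x _; apply/eqP; rewrite eqb0.
  by apply/negP => /afix1P[_ /nfy].
rewrite [RHS]big_mkcond; apply: eq_bigr => x _.
have -> : fixed x y = (x \in afix 'P [set wbase u y]); last by case: ifP.
by congr nat_of_bool; apply/afix1P/afix1P => [[]//|fx]; congr pair.
Qed.

Section Polynomial.
Variable R : realFieldType.

(** For a fixed top element [b], the sum over the base group factors over the coordinates. A
    coordinate fixed by [b] contributes $|A| P_A(t)$ and a moved one $|A|$, so the average over the
    base group is $P_A(t)$ to the number of fixed points of [b]. *)
Lemma fixgf_wr (t : R) :
  fixgf wr_action (wr_group A B) t = fixgf 'P B (fixgf 'P A t).
Proof.
pose F f (b : 'S_n) :=
  (\prod_(y | b y == y) t ^+ #|afix 'P [set (f : {ffun 'I_n -> 'S_m}) y]|)%R.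
rewrite /fixgf [X in (_ * X)%R](_ : _ =
    \sum_(u in wr_group A B) F (wbase u) (wtop u))%R; last first.
  by apply: eq_bigr => u _; rewrite wr_action_fix -prodrXr.
rewrite sum_wr card_wr natrM natrX invfM -mulrA mulrCA mulr_sumr.
congr (_ * _)%R; apply: eq_bigr => b _.
have A0 : (#|A|%:R != 0 :> R)%R by rewrite pnatr_eq0 -lt0n cardG_gt0.
(* Moved coordinates get the factor 1, so that the product runs over all of ['I_n] and can be
   exchanged with the sum. *)
under eq_bigr do rewrite /F big_mkcond.
rewrite -(bigA_distr_big _ (fun y a =>
  if b y == y then t ^+ #|afix 'P [set a]| else 1)%R) /=.
rewrite -exprVn -[X in (_ ^+ X)%R]card_ord -prodr_const -big_split /=.
rewrite -prodr_const [RHS]big_mkcond; apply: eq_bigr => y _ /=.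
rewrite (_ : (y \in _) = (b y == y)); last exact/afix1P/eqP.
by case: eqP => // _; rewrite sumr_const mulVf.
Qed.

End Polynomial.
End ImprimitiveWreath.

(** * Transitivity, separation of points, and blocks of the imprimitive action *)

Lemma transitive_from (gT : finGroupType) (T : finType)
    (to : {action gT &-> T}) (G : {group gT}) (x : T) :
  (forall y, exists2 g, g \in G & to x g = y) ->
  [transitive G, on [set: T] | to].
Proof.
move=> trG; apply/imsetP; exists x; rewrite ?inE //; apply/setP => y.
by rewrite inE; apply/esym/orbitP/trG.
Qed.

(** A point stabiliser fixes no other point. Among primitive groups only regular ones can fail this,
    and for those the product action need not be primitive. *)
Definition separating (gT : finGroupType) (T : finType)
    (to : {action gT &-> T}) (G : {group gT}) :=
  forall x y : T, x != y -> exists g, [/\ g \in G, to x g = x & to y g <> y].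

Lemma relabel_separating (gT : finGroupType) (T : finType)
    (to : {action gT &-> T}) (G : {group gT}) :
  separating to G -> separating 'P (relabel_group to G).
Proof.
move=> sepG i j ij.
have [|g [Gg gi gj]] := sepG (enum_val i) (enum_val j).
  by apply: contraNneq ij => /enum_val_inj ->.
exists (relabel to g); split; first exact: mem_morphim.
  by rewrite -(enum_valK i) /= /aperm relabelE gi.
rewrite -(enum_valK j) /= /aperm relabelE => /enum_rank_inj; exact: gj.
Qed.

Section ImprimitiveWreath.
Variables (m n : nat) (A : {group 'S_m}) (B : {group 'S_n}).

Lemma wr_transitive :
  [transitive A, on [set: 'I_m] | 'P] -> [transitive B, on [set: 'I_n] | 'P] ->
  [transitive wr_group A B, on [set: 'I_m * 'I_n] | wr_action].
Proof.
move=> trA trB; have [/imsetP[x _ _] /imsetP[y _ _]] := (trA, trB).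
apply: (@transitive_from _ _ _ _ (x, y)) => -[x' y'].
have [a Aa ->] := atransP2 trA (in_setT x) (in_setT x').
have [b Bb ->] := atransP2 trB (in_setT y) (in_setT y').
exists (Wreath [ffun=> a] b); last by rewrite /= /wr_imprim /= ffunE.
by rewrite inE Bb andbT; apply/forallP => z; rewrite ffunE.
Qed.

(** The fibres of the second projection are blocks, of size [m > 1] and in number [n > 1]. *)
Lemma wr_not_congruence_simple : (1 < m)%N -> (1 < n)%N ->
  ~ congruence_simple wr_action (wr_group A B).
Proof.
move=> m1 n1 simW.
(* Here [i] ranges over ['I_2]: [x] and [y] pick out the points 0 and 1. *)
pose x i : 'I_m := Ordinal (leq_trans (ltn_ord i) m1).
pose y i : 'I_n := Ordinal (leq_trans (ltn_ord i) n1).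
have [|h|h] := simW (fun p q => p.2 == q.2).
- split=> [p q r|g p q _ /eqP pq]; last by rewrite /= pq.
  by split=> // /eqP ->.
- have := h (x ord0, y ord0) (x ord_max, y ord0) (eqxx _).
  by move/(congr1 (fun p => val p.1)).
- by have := h (x ord0, y ord0) (x ord0, y ord_max).
Qed.

End ImprimitiveWreath.

(** * The affine group $AGL_1(F)$ of a finite field *)

Section AffineGroup.
Variable F : finFieldType.

Let aff_fun (ub : {unit F} * F) (x : F) : F := (val ub.1 * x + ub.2)%R.

Let aff_inj ub : injective (aff_fun ub).
Proof.
by move=> x y /addIr; apply: mulrI; apply: (valP ub.1).
Qed.

Definition aff ub : {perm F} := perm (@aff_inj ub).

Lemma affE ub x : aff ub x = (val ub.1 * x + ub.2)%R.
Proof. by rewrite permE. Qed.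

Lemma aff_group_set : group_set [set aff ub | ub in [set: {unit F} * F]].
Proof.
apply/group_setP; split.
  apply/imsetP; exists (1, 0%R); rewrite ?inE //.
  by apply/permP => x; rewrite affE perm1 /= mul1r addr0.
move=> _ _ /imsetP[[u b] _ ->] /imsetP[[v c] _ ->].
apply/imsetP; exists (u * v, (val v * b + c)%R); rewrite ?inE //.
apply/permP => x; rewrite permM !affE /= mulrDr addrA.
by rewrite [(val u * val v)%R]mulrC mulrA.
Qed.

Canonical aff_group := Group aff_group_set.

Lemma mem_aff ub : aff ub \in aff_group.
Proof. by rewrite imset_f ?inE. Qed.

Lemma aff_injective : injective aff.
Proof.
move=> [u b] [v c] /permP eq_uv.
have := eq_uv 0%R; rewrite !affE /= !mulr0 !add0r => bc.
have := eq_uv 1%R; rewrite !affE /= !mulr1 bc => /addIr/val_inj uv.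
by rewrite uv.
Qed.

Lemma card_aff : #|aff_group| = (#|F|.-1 * #|F|)%N.
Proof.
rewrite card_imset; last exact: aff_injective.
by rewrite cardsT card_prod -cardsT card_finField_unit.
Qed.

Lemma aff_2transitive (x y z w : F) : x != y -> z != w ->
  exists2 g, g \in aff_group & g x = z /\ g y = w.
Proof.
move=> xy zw; have xy0 : (x - y != 0)%R by rewrite subr_eq0.
have Uu : ((z - w) / (x - y))%R \is a GRing.unit.
  by rewrite unitfE mulf_neq0 ?invr_eq0 ?subr_eq0.
exists (aff (FinRing.unit F Uu, z - (z - w) / (x - y) * x)%R).
  exact: mem_aff.
rewrite !affE /=; split; first by rewrite addrC subrK.
by field.
Qed.

Lemma aff_transitive : [transitive aff_group, on [set: F] | 'P].
Proof.
apply: (@transitive_from _ _ _ _ 0%R) => y; exists (aff (1, y)).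
  exact: mem_aff.
by rewrite /= /aperm affE /= mulr0 add0r.
Qed.

(** By 2-transitivity, one related pair of distinct points is carried to every other such pair. *)
Lemma aff_congruence_simple : congruence_simple 'P aff_group.
Proof.
move=> e [eqe Ge].
have [/forallP triv|] := boolP [forall x, [forall y, e x y ==> (x == y)]].
  by left=> x y exy; apply/eqP; have /forallP/(_ y)/implyP := triv x; apply.
rewrite negb_forall => /existsP[x]; rewrite negb_forall => /existsP[y].
rewrite negb_imply => /andP[exy nxy]; right=> z w.
have [->|nzw] := eqVneq z w; first by rewrite (eqe w w w).1.
have [g Gg [<- <-]] := aff_2transitive nxy nzw.
exact: (Ge g x y Gg exy).
Qed.

(** A dilation centred at [x] with multiplier [u != 1] fixes [x] only; such a [u] exists once the
    field has more than two elements. *)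
Lemma aff_separating : (2 < #|F|)%N -> separating 'P aff_group.
Proof.
move=> F_gt2 x y nxy.
have /trivgPn[u _ u1] : [set: {unit F}] != 1%G.
  rewrite trivg_card1 card_finField_unit; apply: contraTneq F_gt2.
  by case: #|F| => // -[|[]].
exists (aff (u, x - val u * x)%R); rewrite /= /aperm !affE /=.
split; [exact: mem_aff|by rewrite addrC subrK|move=> uy].
have : ((val u - 1) * (y - x) == 0)%R.
  apply/eqP; transitivity (val u * y + (x - val u * x) - y)%R; last first.
    by rewrite uy subrr.
  ring.
rewrite mulf_eq0 !subr_eq0 (eq_sym y) (negPf nxy) orbF.
by apply/negP; apply: contraNneq u1 => u1; apply/eqP/val_inj.
Qed.

(** With $q = |F|$, the identity fixes $q$ points, the other $q - 1$ translations none, and the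
    remaining $q(q - 2)$ maps exactly one. The result is arranged to display $P(t) - t$, the
    increment under iteration. *)
Lemma fixgf_aff (R : realFieldType) (t : R) :
  (fixgf 'P aff_group t = t + (t ^+ #|F| - 1 + (1 - t) *+ #|F|)
                              / (#|F|%:R * (#|F|%:R - 1)))%R.
Proof.
have F_gt1 : (1 < #|F|)%N := card_finNzRing_gt1 F.
have fix1 u b : u != 1 -> #|afix 'P [set aff (u, b)]| = 1%N.
  move=> u1; have u1' : (1 - FinRing.uval u != 0)%R.
    by rewrite subr_eq0 eq_sym; apply: contraNneq u1 => u1; apply/eqP/val_inj.
  rewrite -(cards1 (b / (1 - FinRing.uval u))%R); apply: eq_card => x.
  rewrite in_set1; apply/afix1P/eqP; rewrite /= /aperm affE /=.
    by move=> fx; rewrite -[b](addKr (FinRing.uval u * x)%R) fx; field.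
  by move=> ->; field.
have fix0 b : #|afix 'P [set aff (1, b)]| = if b == 0%R then #|F| else 0%N.
  case: eqP => [->|/eqP b0].
    apply: eq_card => x; rewrite [RHS]inE; apply/afix1P.
    by rewrite /= /aperm affE /= mul1r addr0.
  apply: eq_card0 => x; apply/negbTE/afix1P; rewrite /= /aperm affE /= mul1r.
  by move/eqP; rewrite -subr_eq0 addrC addKr (negPf b0).
rewrite /fixgf card_aff big_imset /=; last by move=> ? ? _ _ /aff_injective.
pose f u b : R := (t ^+ #|afix 'P [set aff (u, b)]|)%R.
rewrite (eq_big predT (fun ub => f ub.1 ub.2)) => [|ub|[u b] _] //; last first.
  by rewrite inE.
rewrite -(pair_bigA _ f) /f /=.
rewrite (bigD1 1) //= (bigD1 0%R) //= fix0 eqxx.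
rewrite (eq_bigr (fun=> 1%R)) => [|b /negPf b0]; last by rewrite fix0 b0.
rewrite sumr_const cardC1.
rewrite [X in (_ + X)%R](eq_bigr (fun=> t *+ #|F|)%R); last first.
  move=> u u1; rewrite (eq_bigr (fun=> t)) ?sumr_const // => b _.
  by rewrite fix1 // expr1.
rewrite sumr_const cardC1 -(cardsT {unit F}) card_finField_unit.
have F0 : (#|F|%:R != 0 :> R)%R by rewrite pnatr_eq0 -lt0n ltnW.
have F1 : (#|F|%:R - 1 != 0 :> R)%R by rewrite subr_eq0 (eqr_nat R _ 1) gtn_eqF.
move: (t ^+ #|F|)%R => T.
rewrite -[((1 - t) *+ _)%R]mulr_natr -[(t *+ _ *+ _)%R]mulr_natr.
rewrite -[(t *+ _)%R]mulr_natr natrM -!subn1 !natrB ?subn_gt0 ?(ltnW F_gt1) //.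
by field; rewrite F0 F1.
Qed.

End AffineGroup.

(** * Primitivity of the wreath product in the product action *)

Section ProductAction.
Context {m n : nat}.
Implicit Types (u v : wreath m n) (x y z : {ffun 'I_n -> 'I_m}).

Definition wr_prod x u : {ffun 'I_n -> 'I_m} :=
  [ffun k => wbase u ((wtop u)^-1 k) (x ((wtop u)^-1 k))].

Lemma wr_prod_is_action : is_action [set: wreath m n] wr_prod.
Proof.
apply: is_total_action => [x|x u v]; apply/ffunP => k.
  by rewrite !ffunE /= invg1 !perm1.
by rewrite !ffunE /= ?ffunE invgK invMg !permM permKV.
Qed.

Definition wr_prod_action : {action wreath m n &-> {ffun 'I_n -> 'I_m}} :=
  Action wr_prod_is_action.

Lemma wr_prod_fixP u x :
  reflect (forall k, x (wtop u k) = wbase u k (x k)) (wr_prod_action x u == x).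
Proof.
apply: (iffP eqP) => [/ffunP fx k|fx].
  by rewrite -[LHS]fx ffunE permK.
by apply/ffunP => k; rewrite ffunE -fx permKV.
Qed.

Definition upd x (i : 'I_n) (s : 'I_m) : {ffun 'I_n -> 'I_m} :=
  [ffun k => if k == i then s else x k].

Let base (f : {ffun 'I_n -> 'S_m}) := Wreath f 1 : wreath m n.

Let baseE f x k : wr_prod x (base f) k = f k (x k).
Proof. by rewrite ffunE invg1 !perm1. Qed.

Variables (A : {group 'S_m}) (B : {group 'S_n}).
Hypothesis trA : [transitive A, on [set: 'I_m] | 'P].

Let mem_base (f : {ffun 'I_n -> 'S_m}) :
  (forall k, f k \in A) -> base f \in wr_group A B.
Proof. by move=> Af; rewrite inE group1 andbT; apply/forallP. Qed.

Let base_move x y :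
  exists f : {ffun 'I_n -> 'S_m},
    (forall k, f k \in A) /\ (forall k, f k (x k) = y k).
Proof.
have /fin_all_exists2[f Af fxy] : forall k, exists2 a, a \in A & a (x k) = y k.
  move=> k; have [a Aa ->] := atransP2 trA (in_setT (x k)) (in_setT (y k)).
  by exists a.
by exists (finfun f); split=> k; rewrite ffunE.
Qed.

Lemma wr_prod_transitive :
  [transitive wr_group A B, on [set: {ffun 'I_n -> 'I_m}] | wr_prod_action].
Proof.
have /imsetP[i _ _] := trA; apply: (@transitive_from _ _ _ _ [ffun=> i]) => y.
have [f [Af fy]] := base_move [ffun=> i] y.
by exists (base f); [exact: mem_base|apply/ffunP => k; rewrite baseE fy].
Qed.

Hypothesis sepA : separating 'P A.

(** Where [x] and [y] differ at [i], act in coordinate [i] alone by an element of [A] that fixes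
    [x i] and moves [y i]. *)
Let separate x y : x != y -> exists i s,
  [/\ s != y i & exists2 u, u \in wr_group A B &
      wr_prod x u = x /\ wr_prod y u = upd y i s].
Proof.
move=> nxy; have /existsP[i ni] : [exists i, x i != y i].
  apply: contraNT nxy => /existsPn h; apply/eqP/ffunP => i.
  by apply/eqP/negPn.
have [a [Aa ax ay]] := sepA ni; exists i, (a (y i)); split; first exact/eqP.
exists (base [ffun k => if k == i then a else 1]).
  by apply: mem_base => k; rewrite ffunE; case: ifP.
split; apply/ffunP => k; rewrite baseE !ffunE; case: eqP => [->|_] //;
  by rewrite perm1.
Qed.

Lemma wr_prod_separating : separating wr_prod_action (wr_group A B).
Proof.
move=> x y /separate[i [s [ns [u Wu [ux uy]]]]]; exists u; split=> //.
rewrite /= uy => /ffunP/(_ i); rewrite ffunE eqxx => sy.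
by rewrite sy eqxx in ns.
Qed.

Hypothesis simA : congruence_simple 'P A.
Hypothesis trB : [transitive B, on [set: 'I_n] | 'P].

(* A nontrivial congruence relates two points differing in one coordinate only
   (because [A] is separating), hence all points on that line (because [A] is
   primitive), hence all points on every line (by transitivity). *)
Lemma wr_prod_congruence_simple :
  congruence_simple wr_prod_action (wr_group A B).
Proof.
move=> e [eqe We].
have refl x : e x x by case: (eqe x x x).
have trans x y z : e x y -> e y z -> e x z by case: (eqe x y z) => _ h /h ->.
have [/forallP triv|] := boolP [forall x, [forall y, e x y ==> (x == y)]].
  by left=> x y exy; apply/eqP; have /forallP/(_ y)/implyP := triv x; apply.
rewrite negb_forall => /existsP[x]; rewrite negb_forall => /existsP[y].
rewrite negb_imply => /andP[exy nxy]; right.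
have [i [s [ns [u Wu [ux uy]]]]] := separate nxy.
have eys : e y (upd y i s).
  have := We u x y Wu exy; rewrite /= ux uy; apply: trans.
  by case: (eqe x y x) => _ <-.
have line_y t t' : e (upd y i t) (upd y i t').
  have [|h|//] := simA (e := fun t t' => e (upd y i t) (upd y i t')).
    split=> [? ? ?|a r r' Aa]; first exact: eqe.
    pose f := [ffun k => if k == i then a else 1] : {ffun 'I_n -> 'S_m}.
    have updf q : wr_prod (upd y i q) (base f) = upd y i (a q).
      by apply/ffunP => k; rewrite baseE !ffunE; case: eqP; rewrite ?perm1.
    rewrite /= /aperm -!updf; apply: We; apply: mem_base => k.
    by rewrite ffunE; case: ifP.
  case/eqP: ns; symmetry; apply: h.
  have -> : upd y i (y i) = y; last by [].
  by apply/ffunP => k; rewrite ffunE; case: eqP => [->|].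
have line_i z t t' : e (upd z i t) (upd z i t').
  have [f [Af fy]] := base_move y z.
  have updf q : wr_prod (upd y i q) (base f) = upd z i (f i q).
    by apply/ffunP => k; rewrite baseE !ffunE; case: eqP => [->|].
  rewrite -(permKV (f i) t) -(permKV (f i) t') -!updf; apply: We => //.
  exact: mem_base.
have line j z t t' : e (upd z j t) (upd z j t').
  have [b Bb bij] := atransP2 trB (in_setT i) (in_setT j).
  pose v := Wreath [ffun=> 1] b : wreath m n.
  have updv q : wr_prod (upd [ffun k => z (b k)] i q) v = upd z j q.
    apply/ffunP => k; rewrite !ffunE /= perm1 permKV bij /= /aperm.
    by rewrite (canF_eq (permKV b)).
  rewrite -!updv; apply: We; rewrite // inE Bb andbT.
  by apply/forallP => k; rewrite ffunE.
move=> z w.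
(* From lines to arbitrary pairs: [z] is turned into [w] one coordinate at a time, by induction on a
   list containing all coordinates where they may differ. *)
have : forall k, k \notin enum 'I_n -> z k = w k by move=> k; rewrite mem_enum.
elim: (enum _) z => [|j r IHr] z zw.
  by have -> : z = w by apply/ffunP => k; apply: zw.
apply: (trans _ (upd z j (w j))).
  have {1}-> : z = upd z j (z j); last exact: line.
  by apply/ffunP => k; rewrite ffunE; case: eqP => [->|].
apply: IHr => k kr; rewrite ffunE; case: eqP => [->//|/eqP kj].
by apply: zw; rewrite inE negb_or kj.
Qed.

End ProductAction.

(** * Derangements in the product action with a cyclic top group of prime order *)

Lemma card_nonderangements (R : realFieldType) (gT : finGroupType) (T : finType)
    (to : {action gT &-> T}) (G : {group gT}) :
  (#|[set g in G | [exists x, to x g == x]]|%:R =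
   #|G|%:R * (1 - fixgf to G 0) :> R)%R.
Proof.
rewrite fixgf_derangements mulrBr mulr1 mulrC divfK; last first.
  by rewrite pnatr_eq0 -lt0n cardG_gt0.
apply/eqP; rewrite eq_sym subr_eq -natrD; apply/eqP; congr _%:R%R.
rewrite -(cardsID [set g | [exists x, to x g == x]] G); congr (_ + _)%N.
  by apply: eq_card => g; rewrite !inE.
by apply: eq_card => g; rewrite !inE negb_exists andbC.
Qed.

Section CyclicProduct.
Variables (m p' : nat).
Local Notation p := p'.+1.
Variables (A : {group 'S_m}) (c : 'S_p).
Hypotheses (p_prime : prime p) (order_c : #[c] = p).

Implicit Types f g : {ffun 'I_p -> 'S_m}.

Let fixing := [set a in A | [exists s, 'P%act s a == s]].

Section Holonomy.
Variable b : 'S_p.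
Hypothesis order_b : #[b] = p.

Let T_prime : prime #|'I_p|. Proof. by rewrite card_ord. Qed.
Let order_bT : #[b] = #|'I_p|. Proof. by rewrite card_ord. Qed.

Let expbp : b ^+ p = 1.
Proof. by have := expg_order b; rewrite order_b. Qed.

(** A permutation of prime order [p] on [p] points is a single cycle: point stabilisers in the group
    it generates are trivial, and by [expb_onto] one orbit is everything. *)
Let expb_inj j k : (b ^+ j) ord0 = (b ^+ k) ord0 -> j = k %[mod p].
Proof.
move=> bjk; apply/eqP; rewrite -order_b -eq_expg_mod_order eq_mulgV1.
have := perm_prime_astab T_prime order_bT (ord0 : 'I_p).
move/setP/(_ (b ^+ j * (b ^+ k)^-1)); rewrite inE in_set1 => <-.
rewrite groupMl ?groupV ?mem_cycle //=; apply/astab1P.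
by rewrite /= /aperm permM bjk permK.
Qed.

Let expb_onto k : exists j, (b ^+ j) ord0 = k.
Proof.
have := perm_prime_orbit T_prime order_bT (ord0 : 'I_p).
move/setP/(_ k); rewrite inE => /orbitP[_ /cycleP[j ->] <-].
by exists j.
Qed.

(** A fixed point [x] of [(f, b)] must take the value [transport f k (x ord0)] at
    [(b ^+ k) ord0]. *)
Let transport f k : 'S_m := \prod_(i < k) f ((b ^+ i) ord0).

Let transportS f k : transport f k.+1 = transport f k * f ((b ^+ k) ord0).
Proof. by rewrite /transport big_ord_recr. Qed.

(* A fixed point [x] of [(f, b)] is determined by [x ord0], which has to be
   fixed by the product of [f] around the cycle [b]. *)
Lemma wr_prod_cycle_fix f :
  [exists x, wr_prod_action x (Wreath f b) == x] =
  [exists s, transport f p s == s].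
Proof.
apply/existsP/existsP => [[x /wr_prod_fixP /= fx]|[s /eqP fs]].
  exists (x ord0); suff h k : transport f k (x ord0) = x ((b ^+ k) ord0).
    by rewrite h expbp perm1.
  elim: k => [|k IHk]; first by rewrite /transport big_ord0 !perm1.
  by rewrite transportS permM IHk expgSr permM fx.
(* Conversely, if [s] is fixed by the full product, its transport depends only on [k] modulo [p].
   Hence the point defined below does not depend on the exponents chosen by [idx]. *)
have per k : transport f (k + p) s = transport f k s.
  elim: k => [|k IHk]; first by rewrite add0n fs /transport big_ord0 perm1.
  by rewrite addSn !transportS !permM IHk expgD expbp mulg1.
have per_mod k : transport f (k %% p) s = transport f k s.
  rewrite {2}(divn_eq k p) addnC; elim: (k %/ p) => [|q IHq].
    by rewrite addn0.
  by rewrite mulSn addnCA addnC per.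
have [idx idxK] := fin_all_exists expb_onto.
exists [ffun k => transport f (idx k) s]; apply/wr_prod_fixP => k /=.
rewrite !ffunE -{2}(idxK k) -permM -transportS -per_mod -[RHS]per_mod.
congr (transport f _ s); apply: expb_inj.
by rewrite expgSr permM !idxK.
Qed.

(* Replacing [f ord0] by the product of [f] around the cycle is a bijection of
   [A^p]; [untwist] is its inverse. *)
Let rest f : 'S_m := \prod_(i < p') f ((b ^+ i.+1) ord0).

Let untwist f : {ffun 'I_p -> 'S_m} :=
  [ffun k => if k == ord0 then f ord0 * (rest f)^-1 else f k].

Let expb_neq0 (i : 'I_p') : (b ^+ i.+1) ord0 != ord0.
Proof.
apply/eqP => bi; have := @expb_inj i.+1 0; rewrite expg0 perm1 => /(_ bi).
by rewrite mod0n modn_small // ltnS.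
Qed.

Let rest_untwist f : rest (untwist f) = rest f.
Proof.
by apply: eq_bigr => i _; rewrite ffunE (negPf (expb_neq0 i)).
Qed.

Let transport_untwist f : transport (untwist f) p = f ord0.
Proof.
rewrite /transport big_ord_recl expg0 perm1 -/(rest _) rest_untwist.
by rewrite ffunE eqxx mulgKV.
Qed.

Let untwist_inj : injective untwist.
Proof.
move=> f g fg.
have rfg : rest f = rest g by rewrite -rest_untwist fg rest_untwist.
apply/ffunP => k; have := congr1 (fun h : {ffun _ -> _} => h k) fg.
by rewrite !ffunE; case: eqP => [->|//]; rewrite rfg => /mulIg.
Qed.

Let untwist_mem f : (untwist f \in ffun_on A) = (f \in ffun_on A).
Proof.
have restA g : (forall k, k != ord0 -> g k \in A) -> rest g \in A.
  by move=> gA; apply: group_prod => i _; apply: gA.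
apply/ffun_onP/ffun_onP => fA k.
  have [->|/negPf k0] := eqVneq k ord0; last by have := fA k; rewrite ffunE k0.
  have := fA ord0; rewrite ffunE eqxx groupMr // groupV restA // => j j0.
  by have := fA j; rewrite ffunE (negPf j0).
rewrite ffunE; case: eqP => _; last exact: fA.
by rewrite groupM ?fA // groupV restA // => j _; apply: fA.
Qed.

(** After [untwist], the product around the cycle is [f ord0]: this coordinate must have a fixed
    point, and the other [p'] range freely over [A]. *)
Lemma card_wr_prod_cycle_fix :
  #|[set f in ffun_on A | [exists x, wr_prod_action x (Wreath f b) == x]]| =
  (#|fixing| * #|A| ^ p')%N.
Proof.
rewrite -(card_preimset _ untwist_inj).
pose Q (k : 'I_p) := if k == ord0 then fixing else A : {set 'S_m}.
transitivity (\prod_(k < p) #|Q k|)%N.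
  under [RHS]eq_bigr do rewrite -sum1_card.
  rewrite (bigA_distr_big_dep _ (fun _ _ => 1%N)) /=.
  under [RHS]eq_bigr do rewrite big1 //.
  rewrite sum1_card; apply: eq_card => f.
  rewrite 2!in_set untwist_mem wr_prod_cycle_fix transport_untwist.
  apply/andP/familyP => [[/ffun_onP fA f0] k|fQ].
    by rewrite /Q; case: eqP => [->|_]; rewrite ?in_set fA.
  have := fQ ord0; rewrite /Q eqxx in_set => /andP[fA0 ->]; split=> //.
  apply/ffun_onP => k; have := fQ k; rewrite /Q.
  by case: eqP => [->|].
rewrite big_ord_recl {1}/Q eqxx; congr (_ * _)%N.
by rewrite -[X in (_ ^ X)%N]card_ord -prod_nat_const; apply: eq_bigr.
Qed.

End Holonomy.

(** With trivial top element, a fixed point is a choice of a fixed point in each coordinate. *)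
Lemma card_wr_prod_fix1 :
  #|[set f in ffun_on A |
      [exists x, wr_prod_action x (Wreath f (1 : 'S_p)) == x]]| =
  (#|fixing| ^ p)%N.
Proof.
rewrite -[X in (_ ^ X)%N]card_ord -card_ffun_on; apply: eq_card => f.
rewrite in_set; apply/andP/ffun_onP => [[/ffun_onP fA]|fF].
  case/existsP=> x /wr_prod_fixP fx k.
  rewrite in_set fA; apply/existsP; exists (x k).
  by have := fx k; rewrite /= perm1 /aperm => <-.
split; first by apply/ffun_onP => k; have := fF k; rewrite in_set => /andP[].
have /fin_all_exists[x fx] : forall k, exists s, f k s = s.
  move=> k; have := fF k.
  by rewrite in_set => /andP[_ /existsP[s /eqP fs]]; exists s.
apply/existsP; exists [ffun k => x k]; apply/wr_prod_fixP => k.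
by rewrite /= perm1 !ffunE fx.
Qed.

(** Besides the identity, the top group contains [p'] elements, all of order [p] because [p] is
    prime, and all contributing equally. *)
Lemma card_wr_prod_fix :
  #|[set u in wr_group A <[c]> | [exists x, wr_prod_action x u == x]]| =
  (#|fixing| ^ p + p' * (#|fixing| * #|A| ^ p'))%N.
Proof.
pose F f (b : 'S_p) : nat := [exists x, wr_prod_action x (Wreath f b) == x].
transitivity (\sum_(u in wr_group A <[c]>) F (wbase u) (wtop u))%N.
  rewrite -sum1_card big_mkcond [RHS]big_mkcond; apply: eq_bigr => -[f b] _.
  by rewrite in_set /F; case: (_ \in _) => //=; case: [exists _, _].
rewrite sum_wr.
have sumF b : (\sum_(f in ffun_on A) F f b =
    #|[set f in ffun_on A | [exists x, wr_prod_action x (Wreath f b) == x]]|)%N.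
  rewrite -sum1_card big_mkcond [RHS]big_mkcond; apply: eq_bigr => f _.
  by rewrite in_set /F; case: (_ \in _) => //=; case: [exists _, _].
rewrite (bigD1 1) //= sumF card_wr_prod_fix1; congr (_ + _)%N.
rewrite (eq_bigr (fun=> (#|fixing| * #|A| ^ p')%N)) => [|b /andP[cb b1]].
  rewrite sum_nat_const; congr (_ * _)%N.
  have := cardD1 1 <[c]>; rewrite group1 -orderE order_c add1n => /eq_add_S Ep.
  by rewrite [RHS]Ep; apply: eq_card => b; rewrite !inE andbC.
rewrite sumF card_wr_prod_cycle_fix //; have := order_dvdG cb.
rewrite -orderE order_c => dvd_bp; case/primeP: (p_prime) => _.
by move=> /(_ _ dvd_bp)/orP[|/eqP//]; rewrite order_eq1 (negPf b1).
Qed.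

Lemma fixgf_wr_prod (R : realFieldType) (s := fixgf 'P A 0 : R) :
  (fixgf wr_prod_action (wr_group A <[c]>) 0 =
   s + ((1 - s) - (1 - s) ^+ p) / p%:R)%R.
Proof.
have A0 : (#|A|%:R != 0 :> R)%R by rewrite pnatr_eq0 -lt0n cardG_gt0.
have p0 : (p'%:R + 1 != 0 :> R)%R by rewrite natr1 pnatr_eq0.
have fixE : (#|fixing|%:R = #|A|%:R * (1 - s) :> R)%R.
  exact: card_nonderangements.
have := card_nonderangements R wr_prod_action (wr_group A <[c]>).
rewrite card_wr_prod_fix card_wr -orderE order_c natrD !natrM !natrX fixE.
rewrite !exprS exprMn -natr1; set P := fixgf _ _ _.
have : (#|A|%:R ^+ p' != 0 :> R)%R by rewrite expf_neq0.
move: (#|A|%:R ^+ p')%R ((1 - s) ^+ p')%R => k v k0 h.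
have {}h : (1 - P = ((1 - s) * v + p'%:R * (1 - s)) / (p'%:R + 1))%R.
  apply: (mulfI (mulf_neq0 (mulf_neq0 A0 k0) p0)); rewrite -h.
  by field.
by rewrite -[P](subKr 1%R) h; field.
Qed.

End CyclicProduct.

(** * Approximation by iterating small steps *)

Section Density.
Variable R : archiRealFieldType.

(** Gains of at least [c] force the iterates past [y] after finitely many steps; gains of at most
    [e] put the last iterate before that within [e] of [y]. *)
Lemma iter_approx (f : R -> R) (x y c e : R) : (x <= y -> 0 < c ->
  (forall t, x <= t <= y -> c <= f t - t <= e) ->
  exists k, y - e <= iter k f x <= y)%R.
Proof.
move=> xy c0 fP.
have step k : (exists j, y - e <= iter j f x <= y)%R \/
    (x + c *+ k <= iter k f x <= y)%R.
  elim: k => [|k [IHk|/andP[lek key]]]; [|by left|].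
    by right; rewrite mulr0n addr0 lexx.
  have /fP/andP[cf fe] : (x <= iter k f x <= y)%R.
    by rewrite key (le_trans _ lek) // lerDl mulrn_wge0 // ltW.
  have [fy|yf] := lerP (f (iter k f x)) y; last by left; exists k; lra.
  by right; rewrite andbT iterS mulrSr addrA; lra.
pose N := Num.bound ((y - x) / c)%R; have [//|/andP[le1 le2]] := step N.
have : ((y - x) / c < N%:R)%R.
  by rewrite archi_boundP // divr_ge0 ?subr_ge0 // ltW.
by rewrite ltr_pdivrMr // mulrC mulr_natr; lra.
Qed.

(** The prime is [p'.+1]. Bounding the inverse of [p'] suits the affine steps and also bounds the
    inverse of the prime; [1 < p'] gives a field large enough for [aff_separating]. *)
Lemma inv_prime_lt (e : R) : (0 < e)%R ->
  exists p', [/\ prime p'.+1, (1 < p')%N & (p'%:R^-1 < e)%R].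
Proof.
move=> e0; have [p] := prime_above (maxn 2 (Num.bound e^-1).+1).
rewrite gtn_max => /andP[p2 pb] p_prime; exists p.-1.
case: p p2 pb p_prime => // p p2 pb p_prime; split=> //=.
have p0 : (0 < p%:R :> R)%R by rewrite ltr0n; case: (p) p2.
rewrite invf_plt ?posrE //; apply: lt_le_trans (archi_boundP _) _.
  by rewrite invr_ge0 ltW.
by rewrite ler_nat -ltnS; apply: ltnW.
Qed.

Lemma transitive_gt0 n (G : {group 'S_n}) :
  [transitive G, on [set: 'I_n] | 'P] -> (0 < n)%N.
Proof. by case/imsetP => x _ _; apply: leq_ltn_trans (ltn_ord x). Qed.

(** The invariant of the iteration: primitivity together with [separating], which the next product
    action requires. *)
Let good m (A : {group 'S_m}) :=
  [/\ [transitive A, on [set: 'I_m] | 'P], congruence_simple 'P A &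
      separating 'P A].

Let prod_step (p' : nat) (s : R) : R :=
  (s + ((1 - s) - (1 - s) ^+ p'.+1) / p'.+1%:R)%R.

Let good_iter p' k m (A : {group 'S_m}) : prime p'.+1 -> good A ->
  exists m' (A' : {group 'S_m'}), good A' /\
    fixgf 'P A' 0%R = iter k (prod_step p') (fixgf 'P A 0%R).
Proof.
move=> p_prime goodA; elim: k => [|k [n [B [[trB simB sepB] fB]]]].
  by exists m, A.
have [c _ order_c] : {c : 'S_p'.+1 | c \in [set: 'S_p'.+1] & #[c] = p'.+1}.
  by apply: Cauchy; rewrite // cardsT card_Sn dvdn_fact /= ?leqnn.
have trc : [transitive <[c]>, on [set: 'I_p'.+1] | 'P].
  by apply: perm_prime_atrans; rewrite // card_ord.
exists _, (relabel_group wr_prod_action (wr_group B <[c]>)); split; last first.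
  by rewrite fixgf_relabel fixgf_wr_prod // fB.
split.
- exact/relabel_transitive/wr_prod_transitive.
- exact/relabel_congruence_simple/wr_prod_congruence_simple.
- exact/relabel_separating/wr_prod_separating.
Qed.

Lemma primitive_fixgf0_approx (t e : R) : (0 < t < 1 -> 0 < e ->
  exists m (A : {group 'S_m}), [/\ (0 < m)%N,
    [primitive A, on [set: 'I_m] | 'P] & `|fixgf 'P A 0 - t| < e])%R.
Proof.
case/andP=> t0 t1 e0.
have [q' [q_prime q2 qt]] := inv_prime_lt t0.
have [p' [p_prime p2 pe]] := inv_prime_lt e0.
have Fq : #|'F_q'.+1| = q'.+1 := card_Fp q_prime.
pose A := relabel_group 'P (aff_group 'F_q'.+1).
have goodA : good A.
  split; first exact/relabel_transitive/aff_transitive.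
    exact/relabel_congruence_simple/aff_congruence_simple.
  by apply/relabel_separating/aff_separating; rewrite Fq.
have fA : (fixgf 'P A 0 = q'.+1%:R^-1 :> R)%R.
  rewrite fixgf_relabel fixgf_aff Fq expr0n /= -mulr_natr -natr1.
  have : (q'%:R != 0 :> R)%R by rewrite pnatr_eq0; case: (q') q2.
  have : (q'%:R + 1 != 0 :> R)%R by rewrite natr1 pnatr_eq0.
  by move=> h1 h2; field; rewrite h1 addrK h2.
have q0 : (0 < q'%:R :> R)%R by rewrite ltr0n; case: (q') q2.
have p0 : (0 < p'%:R :> R)%R by rewrite ltr0n; case: (p') p2.
have Sq0 : (0 < q'.+1%:R^-1 :> R)%R by rewrite invr_gt0 ltr0n.
have Sqt : (q'.+1%:R^-1 <= t)%R.
  by rewrite (le_trans _ (ltW qt)) // lef_pV2 ?posrE ?ltr0Sn // ler_nat.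
have Spe : (p'.+1%:R^-1 < e)%R.
  by rewrite (le_lt_trans _ pe) // lef_pV2 ?posrE ?ltr0Sn // ler_nat.
have Sp0 : (0 < p'.+1%:R^-1 :> R)%R by rewrite invr_gt0 ltr0n.
(* With $p$ and $q$ the two primes and $1/q \le s \le t$, one has $(1 - s) - (1 - s)^p \ge (1 - s)s
   \ge (1 - t)/q$, whence the least gain; it is positive as $t < 1$. *)
have [|s /andP[qs st]|k] := @iter_approx (prod_step p') (q'.+1%:R^-1) t
    ((1 - t) * q'.+1%:R^-1 * p'.+1%:R^-1) (p'.+1%:R^-1) Sqt.
- by rewrite !mulr_gt0 // subr_gt0.
- rewrite /prod_step addrAC subrr add0r ler_pM2r //.
  have s0 : (0 <= s)%R := le_trans (ltW Sq0) qs.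
  have s1 : (s <= 1)%R := le_trans st (ltW t1).
  have u0 : (0 <= 1 - s)%R by rewrite subr_ge0.
  have u1 : (1 - s <= 1)%R by rewrite gerBl.
  have up0 : (0 <= (1 - s) ^+ p'.+1)%R by rewrite exprn_ge0.
  have up : ((1 - s) ^+ p'.+1 <= (1 - s) ^+ 2)%R by rewrite ler_wiXn2l // leqW.
  apply/andP; split.
    apply: (@le_trans _ _ ((1 - s) * s)%R).
      by rewrite ler_pM ?lerB ?subr_ge0 ?(ltW t1) ?(ltW Sq0).
    by move: up; rewrite expr2; move: (_ ^+ _)%R => w; nra.
  by rewrite -[leRHS]mul1r ler_wpM2r ?(ltW Sp0) //; lra.
rewrite -fA; have [m [B [[trB simB sepB] <-]]] := good_iter k p_prime goodA.
move=> /andP[ltB Bt]; exists m, B; split.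
- exact: transitive_gt0 trB.
- by apply/primitive_congruenceP.
- by rewrite ltr_norml; move: ltB Spe; move: (_^-1)%R => d; lra.
Qed.

Let aff_step (q : nat) (t : R) : R :=
  (t + (t ^+ q - 1 + (1 - t) *+ q) / (q%:R * (q%:R - 1)))%R.

Let aff_perm q := relabel_group 'P (aff_group 'F_q).

Let aff_perm_transitive q :
  [transitive aff_perm q, on [set: 'I_#|'F_q|] | 'P].
Proof. by apply: relabel_transitive; apply: aff_transitive. Qed.

Let fixgf_aff_perm q (t : R) : prime q ->
  fixgf 'P (aff_perm q) t = aff_step q t.
Proof. by move=> q_prime; rewrite fixgf_relabel fixgf_aff card_Fp. Qed.

Let aff_wr_iter q k : prime q ->
  exists n (B : {group 'S_n}), [/\ (1 < n)%N,
    [transitive B, on [set: 'I_n] | 'P] &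
    forall t : R, fixgf 'P B t = iter k.+1 (aff_step q) t].
Proof.
move=> q_prime; elim: k => [|k [n [B [n1 trB fB]]]].
  exists _, (aff_perm q); split; last by move=> t; rewrite fixgf_aff_perm.
    by rewrite card_Fp ?prime_gt1.
  exact: aff_perm_transitive.
exists _, (relabel_group wr_action (wr_group (aff_perm q) B)); split.
- by rewrite card_prod !card_ord (leq_trans n1) // leq_pmull.
- by apply/relabel_transitive/wr_transitive => //; apply: aff_perm_transitive.
- by move=> t; rewrite fixgf_relabel fixgf_wr fB fixgf_aff_perm // -iterSr.
Qed.

(** At least two factors are present, hence the exponent [k.+2]: one affine factor for the blocks
    and a group of degree above 1 permuting them. *)
Let imprimitive_aff q k : prime q ->
  exists n (B : {group 'S_n}), [/\ (0 < n)%N,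
    [transitive B, on [set: 'I_n] | 'P],
    ~~ [primitive B, on [set: 'I_n] | 'P] &
    forall t : R, fixgf 'P B t = iter k.+2 (aff_step q) t].
Proof.
move=> q_prime; have [n [B [n1 trB fB]]] := aff_wr_iter k q_prime.
pose W := relabel_group wr_action (wr_group (aff_perm q) B).
have trW : [transitive W, on setT | 'P].
  by apply/relabel_transitive/wr_transitive => //; apply: aff_perm_transitive.
exists _, W; split=> //.
- exact: transitive_gt0 trW.
- apply/negP => /primitive_congruenceP[_ /relabel_congruence_simple].
  by apply: wr_not_congruence_simple; rewrite // card_Fp // prime_gt1.
- by move=> t; rewrite fixgf_relabel fixgf_wr fB fixgf_aff_perm // -iterSr.
Qed.

(** The right-hand side equals $u^2$ for $n = 0$ and does not decrease with $n$. With $u = 1 - t$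
    this bounds the gain of an affine step from below, away from its double zero $t = 1$. *)
Lemma ler_Bernoulli2 n (u : R) :
  (0 <= u <= 1 -> u ^+ 2 <= (1 - u) ^+ n.+2 - 1 + u *+ n.+2)%R.
Proof.
case/andP=> u0 u1; elim: n => [|n IHn].
  by rewrite -mulr_natr !expr2; nra.
have u1' : (0 <= 1 - u)%R by rewrite subr_ge0.
have := ler_wpM2l u1' IHn; rewrite [((1 - u) ^+ n.+3)%R]exprS.
rewrite !(mulrS u) -[(u *+ n)%R]mulr_natr.
move: (_ ^+ n.+2)%R => w.
by have := mulr_ge0 (mulr_ge0 u0 u0) (ler0n R n); rewrite expr2; nra.
Qed.

Lemma imprimitive_fixgf_approx (a t e : R) : (0 <= a -> a <= t <= 1 -> 0 < e ->
  exists n (B : {group 'S_n}), [/\ (0 < n)%N,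
    [transitive B, on [set: 'I_n] | 'P],
    ~~ [primitive B, on [set: 'I_n] | 'P] &
    `|fixgf 'P B a - t| < e])%R.
Proof.
move=> a0 /andP[at_ t1] e0.
(* Each step gains less than $e/4$, so the two compulsory steps together gain less than $e/2$. *)
have [q' [q_prime q2 qe]] := inv_prime_lt (divr_gt0 e0 (ltr0n R 4)).
have q0 : (0 < q'%:R :> R)%R by rewrite ltr0n; case: (q') q2.
pose C := (q'.+1%:R * (q'.+1%:R - 1) : R)%R.
have CE : C = (q'.+1%:R * q'%:R)%R by rewrite /C -{2}natr1 addrK.
have C0 : (0 < C)%R by rewrite CE mulr_gt0 // ltr0n.
pose f := aff_step q'.+1.
have step_ge s : (0 <= s <= 1 -> (1 - s) ^+ 2 / C <= f s - s)%R.
  move=> /andP[s0 s1]; rewrite /f /aff_step addrAC subrr add0r -/C.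
  rewrite ler_pM2r ?invr_gt0 //; case: (q') q2 => // q _.
  by rewrite -{2}[s](subKr 1%R) ler_Bernoulli2 // subr_ge0 s1 gerBl.
have step_le s : (0 <= s <= 1 -> f s - s <= q'%:R^-1)%R.
  move=> /andP[s0 s1]; rewrite /f /aff_step addrAC subrr add0r -/C.
  rewrite ler_pdivrMr // CE mulrC mulfK ?gt_eqF // -mulr_natr.
  have : (s ^+ q'.+1 <= 1)%R by rewrite exprn_ile1.
  have := ler0n R q'.+1; nra.
have f_le1 s : (0 <= s <= 1 -> f s <= 1)%R.
  move=> /andP[s0 s1]; rewrite /f -fixgf_aff_perm //.
  by rewrite -(fixgf1 R 'P (aff_perm q'.+1)) le_fixgf.
have f_ge s : (0 <= s <= 1 -> s <= f s)%R.
  move=> s01; rewrite -subr_ge0 (le_trans _ (step_ge s s01)) //.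
  by rewrite divr_ge0 ?sqr_ge0 // ltW.
set d := (q'%:R^-1)%R in qe step_le *.
have d0 : (0 < d)%R by rewrite invr_gt0.
suff [k kP] : exists k, (`|iter k f (f (f a)) - t| < e)%R.
  have [n [B [n0 trB impB fB]]] := imprimitive_aff k q_prime.
  by exists n, B; split=> //; rewrite fB !iterSr.
have a01 : (0 <= a <= 1)%R by lra.
have [[fa0 fa1] fad] := (f_ge a a01, f_le1 a a01, step_le a a01).
have fa01 : (0 <= f a <= 1)%R by lra.
have [[ffa0 ffa1] ffad] := (f_ge _ fa01, f_le1 _ fa01, step_le _ fa01).
(* The target is kept below 1, where the gain would vanish, at a cost of at most $e/2$. *)
pose y := Order.min t (1 - e / 2)%R.
have [yt ty] : (y <= t)%R /\ (t - e / 2 <= y)%R.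
  by rewrite ge_min le_min lexx; lra.
have y1 : (y < 1)%R by rewrite gt_min; apply/orP; right; lra.
(* If two steps already pass [y], they end less than $e/2$ above $a \le t$, and no further step is
   taken. *)
have [lt|le] := ltrP y (f (f a)).
  by exists 0%N; rewrite /= ltr_norml; lra.
have [|s /andP[s0 sy]|k] := @iter_approx f (f (f a)) y
    ((1 - y) ^+ 2 / C) d le.
- by rewrite divr_gt0 // exprn_gt0 // subr_gt0.
- have s01 : (0 <= s <= 1)%R by lra.
  rewrite step_le // andbT (le_trans _ (step_ge s s01)) //.
  by rewrite ler_pM2r ?invr_gt0 // lerXn2r ?nnegrE ?subr_ge0; lra.
by case/andP=> k1 k2; exists k; rewrite ltr_norml; lra.
Qed.

End Density.

(* Continuity, closures and the density theorem over the reals *)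
From mathcomp Require Import all_classical all_reals all_analysis.
Import numFieldNormedType.Exports.
Local Open Scope ring_scope.
Local Open Scope classical_set_scope.

Lemma delta_fixgf (R : realType) (gT : finGroupType) (T : finType)
    (to : {action gT &-> T}) (G : {group gT}) :
  delta R to G = fixgf to G 0.
Proof. by rewrite fixgf_derangements. Qed.

Lemma delta_wrI_fixgf (R : realType) m n (A : {group 'S_m}) (B : {group 'S_n}) :
  delta_wrI R A B = fixgf 'P%act B (delta_perm R A).
Proof. by rewrite /delta_wrI /delta_perm !delta_fixgf fixgf_wr. Qed.

Lemma delta_perm_itv (R : realType) n (G : {group 'S_n}) :
  0 <= delta_perm R G <= 1.
Proof.
rewrite /delta_perm delta_fixgf -(fixgf1 R 'P%act G) le_fixgf // andbT.
by rewrite fixgf_derangements divr_ge0 ?ler0n.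
Qed.

Lemma closure_approx (R : realType) (S : set R) (y : R) :
  (forall e, 0 < e -> exists2 s, S s & `|s - y| < e) -> closure S y.
Proof.
move=> apS U /nbhs_ballP[e /= e0 eU]; have [s Ss sy] := apS e e0.
by exists s; split=> //; apply: eU; rewrite /ball /= distrC.
Qed.

Lemma continuous_fixgf (R : realType) (gT : finGroupType) (T : finType)
    (to : {action gT &-> T}) (G : {group gT}) :
  continuous (fixgf to G : R -> R).
Proof.
rewrite (_ : fixgf to G = horner (#|G|%:R^-1 *:
  (\sum_(g in G) 'X ^+ #|afix to [set g]%SET|)%R : {poly R})).
  exact: continuous_horner.
by apply/funext => t; rewrite fixgf_horner.
Qed.

Lemma delta_primitive_dense (R : realType) (t e : R) : 0 <= t <= 1 -> 0 < e ->
  exists m (A : {group 'S_m}),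
    [/\ (0 < m)%N, perm_primitive A & `|delta_perm R A - t| < e].
Proof.
move=> /andP[t0 t1] e0; pose d := Order.min (e / 2) (1 / 2).
have [d0 de d1] : [/\ 0 < d, d <= e / 2 & d <= 1 / 2].
  by rewrite /d lt_min !ge_min !lexx orbT; split=> //; lra.
(* Moving [t] towards $1/2$ by at most $d/2$ avoids the endpoints 0 and 1; the total error stays
   below $3d/2 \le 3e/4$. *)
pose t' := t + d * (1 / 2 - t).
have t'01 : 0 < t' < 1 by rewrite /t'; nra.
have [m [A [m0 primA At]]] := primitive_fixgf0_approx t'01 d0.
exists m, A; split=> //; rewrite /delta_perm delta_fixgf.
by move: At; rewrite !ltr_norml /t'; nra.
Qed.

Theorem theorem1p2 (R : realType) :
  (forall (n : nat) (B : {group 'S_n}), (0 < n)%N ->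
     dense_in
       [set d : R | exists (m : nat) (A : {group 'S_m}),
          [/\ (0 < m)%N, perm_primitive A & d = delta_wrI R A B]]
       `[delta_perm R B, 1])
  /\
  (forall (m : nat) (A : {group 'S_m}), (0 < m)%N ->
     dense_in
       [set d : R | exists (n : nat) (B : {group 'S_n}),
          [/\ (0 < n)%N, perm_imprimitive B & d = delta_wrI R A B]]
       `[delta_perm R A, 1]).
Proof.
split=> [n B n0|m A m0]; split.
- move=> _ [m [A [_ _ ->]]]; rewrite /= in_itv /= delta_wrI_fixgf.
  have /andP[A0 A1] := delta_perm_itv R A.
  rewrite /delta_perm [X in X <= _]delta_fixgf le_fixgf //=.
  by rewrite -(fixgf1 R 'P%act B) le_fixgf.
- move=> y; rewrite /= in_itv /= /delta_perm delta_fixgf => /andP[y0 y1].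
  (* Write $y = P_B(t)$; continuity at [t] then reduces density near [y] to density of the values
     [delta_perm R A] near [t]. *)
  have [||t] := @IVT R (fixgf 'P%act B) 0 1 y ler01.
  + exact/continuous_subspaceT/continuous_fixgf.
  + by rewrite fixgf1 ge_min le_max y0 y1 orbT.
  rewrite in_itv /= => t01 <- U /(@continuous_fixgf R _ _ 'P%act B t).
  case/nbhs_ballP => e /= e0 eU.
  have [m [A [m0 primA At]]] := delta_primitive_dense t01 e0.
  exists (delta_wrI R A B); split; first by exists m, A.
  by rewrite delta_wrI_fixgf; apply: eU; rewrite /ball /= distrC.
- move=> _ [n [B [_ /andP[trB _] ->]]]; rewrite /= in_itv /= delta_wrI_fixgf.
  have /andP[A0 A1] := delta_perm_itv R A.
  (* The lower bound is $P_B(t) \ge t$ at [t = delta_perm R A], which uses the transitivity of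
     [B]. *)
  rewrite fixgf_ge ?A0 //=.
  by rewrite -(fixgf1 R 'P%act B) le_fixgf.
- move=> y; rewrite /= in_itv /= => yA; apply: closure_approx => e e0.
  have /andP[A0 _] := delta_perm_itv R A.
  have [n [B [n0 trB impB By]]] := imprimitive_fixgf_approx A0 yA e0.
  exists (delta_wrI R A B); last by rewrite delta_wrI_fixgf.
  by exists n, B; split=> //; apply/andP.
Qed.
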